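(* Let $A$ be a bi-quadratic algebra on 3 generators over a field $K$ with parameters $q_1,q_2,q_3\in K^\times$. Suppose that all $q_i\ne 1$, $q_1-q_3=0$ and $1-q_1q_2\ne 0$. Then (up to $G_3'$): $$x_2x_1=q_1x_1x_2,\quad x_3x_1=q_2x_1x_3+\beta x_2+b_2,\quad x_3x_2=q_1x_2x_3$$ where $\beta,b_2\in\{0,1\}$.
   Context: Let $K$ be a field, $K^\times=K\setminus\{0\}$. A bi-quadratic algebra on 3 generators is a $K$-algebra $A$ generated by $x_1,x_2,x_3$ subject to the defining relations $x_2x_1-q_1x_1x_2=ax_1+bx_2+cx_3+b_1$, $x_3x_1-q_2x_1x_3=\alpha x_1+\beta x_2+\gamma x_3+b_2$, $x_3x_2-q_3x_2x_3=\lambda x_1+\mu x_2+\nu x_3+b_3$, where $q_1,q_2,q_3\in K^\times$ and the other coefficients are in $K$, such that the monomials $x_1^ix_2^jx_3^k$ ($i,j,k\ge0$) form a $K$-basis of $A$ (PBW basis). $G_3'$ is the group of changes of generators generated by the affine changes $x_i\mapsto\lambda_ix_i+\mu_i$ ($\lambda_i\in K^\times$, $\mu_i\in K$) and the permutations $x_i\mapsto x_{\sigma(i)}$, $\sigma\in S_3$. ''Up to $G_3'$'' means: after such a change of canonical generators the new canonical generators (again denoted $x_1,x_2,x_3$) have the displayed defining relations (with new parameters denoted by the same letters). *)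

(* Defs.v *)
From HB Require Import structures.
From mathcomp Require Import all_boot all_fingroup all_algebra.
From mathcomp Require Import finmap monalg.

Set Implicit Arguments.
Unset Strict Implicit.
Unset Printing Implicit Defensive.

Import GRing.Theory.
Local Open Scope ring_scope.

Section Presentations.

Variables (K : fieldType) (I : choiceType).

(* The free associative unital algebra K<X_i | i : I>, i.e. the monoid algebra
   of the free monoid on I. *)
Definition free_alg := {malg K[{fmonom I}]}.

Definition gen (i : I) : free_alg := << fmu i >>.

(* The algebra morphism from the free algebra to A that sends X_i to x i. *)
Definition eval_free (A : algType K) (x : I -> A) (f : free_alg) : A :=
  \sum_(w <- msupp f) f@_w *: \prod_(i <- w) x i.

Definition in_ideal (rs : seq free_alg) (f : free_alg) : Prop :=
  exists2 s : seq (free_alg * free_alg * free_alg),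
    all (fun t => t.1.2 \in rs) s & f = \sum_(t <- s) t.1.1 * t.1.2 * t.2.

(* A is generated by the x i subject to the defining relations r = 0, r in rs:
   x induces an isomorphism from the quotient of the free algebra by the
   two-sided ideal generated by rs onto A. *)
Definition presented (A : algType K) (x : I -> A) (rs : seq free_alg) : Prop :=
  (forall u : A, exists f, eval_free x f = u) /\
  (forall f, eval_free x f = 0 <-> in_ideal rs f).

(* The family e is a basis of V: every vector is a unique finitely supported
   linear combination of the e j. *)
Definition lin_comb (V : lmodType K) (J : choiceType) (e : J -> V)
    (c : {malg K[J]}) : V :=
  \sum_(j <- msupp c) c@_j *: e j.

Definition is_basis (V : lmodType K) (J : choiceType) (e : J -> V) : Prop :=
  injective (lin_comb e) /\ (forall v : V, exists c, lin_comb e c = v).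

End Presentations.

Section Biquadratic.

Variable K : fieldType.

(* The generators x_1, x_2, x_3 are indexed by 0, 1, 2 in 'I_3. *)
Definition i1 : 'I_3 := inord 0.
Definition i2 : 'I_3 := inord 1.
Definition i3 : 'I_3 := inord 2.

(* (a, b, c, d) stands for a X_1 + b X_2 + c X_3 + d. *)
Definition affine_form (l : K * K * K * K) : free_alg K 'I_3 :=
  let: (a, b, c, d) := l in
  a *: gen K i1 + b *: gen K i2 + c *: gen K i3 + d%:A.

Definition biquad_rel (j i : 'I_3) (q : K) (l : K * K * K * K) :
    free_alg K 'I_3 :=
  gen K j * gen K i - q *: (gen K i * gen K j) - affine_form l.

Definition pbw_monomial (A : algType K) (x : 'I_3 -> A)
    (m : nat * nat * nat) : A :=
  let: (i, j, k) := m in x i1 ^+ i * x i2 ^+ j * x i3 ^+ k.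

(* A is a bi-quadratic algebra with canonical generators x and relations
     x_2 x_1 - q_1 x_1 x_2 = l1,
     x_3 x_1 - q_2 x_1 x_3 = l2,
     x_3 x_2 - q_3 x_2 x_3 = l3,
   where q = (q_1, q_2, q_3). *)
Definition biquadratic (A : algType K) (x : 'I_3 -> A) (q : K * K * K)
    (l1 l2 l3 : K * K * K * K) : Prop :=
  let: (q1, q2, q3) := q in
  [/\ [/\ q1 != 0, q2 != 0 & q3 != 0],
      presented x [:: biquad_rel i2 i1 q1 l1;
                      biquad_rel i3 i1 q2 l2;
                      biquad_rel i3 i2 q3 l3]
    & is_basis (pbw_monomial x)].

(* G3' x y: the triple y is obtained from x by an element of the group of
   changes of generators generated by the affine changes and the permutations.
   Both kinds of generators are closed under inverses, so closing under
   composition already yields the group. *)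
Inductive G3' (A : algType K) (x : 'I_3 -> A) : ('I_3 -> A) -> Prop :=
| G3'_id : G3' x x
| G3'_affine (y : 'I_3 -> A) (lam mu : 'I_3 -> K) :
    G3' x y -> (forall i, lam i != 0) ->
    G3' x (fun i => lam i *: y i + (mu i)%:A)
| G3'_perm (y : 'I_3 -> A) (s : 'S_3) :
    G3' x y -> G3' x (fun i => y (s i)).

End Biquadratic.

(* Main.v *)
Require Import Defs.
From HB Require Import structures.
From mathcomp Require Import all_boot all_algebra.
From mathcomp Require Import finmap monalg ring.

(* Write x, y, z for the generators. Since no q_i is 1, translating y, x and z
   kills a, b and alpha, respectively. Comparing the PBW expansions of z (y x)
   and (z y) x then forces all the other coefficients except beta and b_2 to
   vanish: those of x^2, z^2, x and z appear multiplied by 1 - q_1 q_2, those of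
   the mixed monomials by q_i (q_j - 1). Rescaling x normalises b_2, and then
   rescaling y normalises beta. *)

Set Implicit Arguments.
Unset Strict Implicit.
Unset Printing Implicit Defensive.

Import GRing.Theory.
Local Open Scope ring_scope.

(** * Linear forms, linear combinations and coordinates *)

Lemma scalarDZ (K : pzRingType) (V : lmodType K) (phi : V -> K) :
  scalar phi ->
  {morph phi : u v / u + v} * (forall k, {morph phi : u / k *: u >-> k * u}).
Proof.
move=> lin; have DE : {morph phi : u v / u + v}.
  by move=> u v; rewrite -[u]scale1r lin mul1r scale1r.
split=> // k u; have E0 : phi 0 = 0 by apply: (addrI (phi 0)); rewrite -DE !addr0.
by rewrite -[k *: u]addr0 lin E0 addr0.
Qed.

Section LinComb.

Variables (K : fieldType) (J : choiceType).

Section Fix.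

Variables (V : lmodType K) (e : J -> V).

(** Indices outside the support contribute zero, so several combinations can be summed over one
    common finite set. *)
Lemma lin_combEw (d : {fset J}) (c : {malg K[J]}) :
  (msupp c `<=` d)%fset -> lin_comb e c = \sum_(j <- d) c@_j *: e j.
Proof.
move=> le; apply: big_fset_incl => // j _ /mcoeff_outdom ->.
by rewrite scale0r.
Qed.

Lemma lin_comb_is_linear : linear (lin_comb e).
Proof.
move=> k c c'; pose d := (msupp c `|` msupp c' `|` msupp (k *: c + c'))%fset.
rewrite !(@lin_combEw d) ?scaler_sumr -?big_split /=.
- by apply: eq_bigr => j _; rewrite mcoeffD mcoeffZ scalerDl scalerA.
- by rewrite /d -fsetUA fsubsetU // fsubsetUl orbT.
- by rewrite /d -fsetUA fsubsetUl.
- by rewrite /d fsubsetUr.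
Qed.

HB.instance Definition _ :=
  GRing.isLinear.Build K {malg K[J]} V *:%R (lin_comb e) lin_comb_is_linear.

Lemma lin_combU j : lin_comb e << j >> = e j.
Proof.
by rewrite (@lin_combEw [fset j]%fset) ?msuppU_le // big_seq_fset1 mcoeffUU scale1r.
Qed.

End Fix.

Lemma malg_lin_comb (c : {malg K[J]}) : lin_comb (fun j => << j >>) c = c.
Proof.
rewrite [RHS]monalgE; apply: eq_bigr => j _; apply/malgP => k.
by rewrite mcoeffZ !mcoeffU mulrnAr mulr1.
Qed.

Lemma lin_comb_map (V W : lmodType K) (h : {linear V -> W}) (e : J -> V)
  (c : {malg K[J]}) : h (lin_comb e c) = lin_comb (fun j => h (e j)) c.
Proof. by rewrite linear_sum; apply: eq_bigr => j _; rewrite linearZ. Qed.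

Lemma eq_lin_comb (V : lmodType K) (e e' : J -> V) :
  e =1 e' -> lin_comb e =1 lin_comb e'.
Proof. by move=> ee c; apply: eq_bigr => j _; rewrite ee. Qed.

Lemma malg_linear_ext (V : lmodType K) (h h' : {linear {malg K[J]} -> V}) :
  (forall j, h << j >> = h' << j >>) -> h =1 h'.
Proof.
by move=> hh c; rewrite -[c]malg_lin_comb !lin_comb_map; apply: eq_lin_comb.
Qed.

(** Surjectivity provides some coordinate family for each vector; injectivity makes it unique, hence
    linear in the vector, and equal to [<< k >>] at [e k]. *)
Lemma basis_coord (V : lmodType K) (e : J -> V) (j : J) :
  is_basis e ->
  exists2 phi : V -> K, scalar phi & forall k, phi (e k) = (k == j)%:R.
Proof.
case=> inj sur.
(* The boolean equality allows [xchoose] to turn existence of coordinates into a function [g]. *)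
have ex v : exists c, lin_comb e c == v by have [c <-] := sur v; exists c.
pose g v := xchoose (ex v); have gK v : lin_comb e (g v) = v.
  exact/eqP/(xchooseP (ex v)).
exists (fun v => (g v)@_j) => [k u v|k].
  rewrite -mcoeffZ -mcoeffD; congr (_ @_ j).
  by apply: inj; rewrite linearP /= !gK.
have -> : g (e k) = << k >> by apply: inj; rewrite gK lin_combU.
exact: mcoeffU.
Qed.

End LinComb.

(** * The free algebra: evaluation, ideals, presentations *)

Lemma malg_scalerAr (K : comNzRingType) (M : monomType) (k : K) (f g : {malg K[M]}) :
  k *: (f * g) = f * (k *: g).
Proof.
apply/malgP => w; rewrite mcoeffZ !mcoeffMl mulr_sumr; apply: eq_bigr => u _.
(* For [k = 0] the support of [k *: g] shrinks, so the inner sum is first extended to the support of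
   [g]. *)
rewrite (@big_fset_incl _ _ _ _ (msupp (k *: g)) (msupp g)) ?msuppZ_le //.
  by rewrite mulr_sumr; apply: eq_bigr => v _; rewrite mcoeffZ mulrnAr mulrCA.
by move=> v _ /mcoeff_outdom ->; rewrite mulr0 mul0rn.
Qed.

Section FreeAlgebra.

Variables (K : fieldType) (I : choiceType).

HB.instance Definition _ := GRing.Lalgebra.on (free_alg K I).

Lemma free_scalerAr (k : K) (f g : free_alg K I) : k *: (f * g) = f * (k *: g).
Proof. exact: malg_scalerAr. Qed.

HB.instance Definition _ :=
  GRing.Lalgebra_isAlgebra.Build K (free_alg K I) free_scalerAr.

Section Eval.

Variables (A : algType K) (x : I -> A).

Lemma eval_free_is_linear : linear (eval_free x).
Proof. exact: lin_comb_is_linear. Qed.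

HB.instance Definition _ :=
  GRing.isLinear.Build K (free_alg K I) A *:%R (eval_free x) eval_free_is_linear.

Lemma eval_freeU (w : {fmonom I}) :
  eval_free x << w >> = \prod_(i <- w) x i.
Proof. exact: (lin_combU (fun w : {fmonom I} => \prod_(i <- w) x i)). Qed.

(** By bilinearity it suffices to treat two words, whose product is their concatenation. *)
Lemma eval_free_is_multiplicative : multiplicative (eval_free x).
Proof.
split=> [f g|]; last by rewrite eval_freeU fm1 big_nil.
have E (h : free_alg K I) :
    h = \sum_(w <- msupp h) h@_w *: (<< w >> : free_alg K I).
  by rewrite -[LHS]malg_lin_comb.
rewrite {1}[f]E mulr_suml linear_sum /eval_free mulr_suml.
apply: eq_bigr => u _; rewrite -scalerAl linearZ /= -[RHS]scalerAl; congr (_ *: _).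
rewrite {1}[g]E mulr_sumr linear_sum mulr_sumr.
apply: eq_bigr => v _; rewrite -free_scalerAr linearZ /= -[RHS]scalerAr.
by congr (_ *: _); rewrite malgM_def fgmulUU mulr1 eval_freeU fmM big_cat.
Qed.

HB.instance Definition _ :=
  GRing.isMultiplicative.Build (free_alg K I) A (eval_free x)
    eval_free_is_multiplicative.

Lemma eval_free1 : eval_free x 1 = 1.
Proof. exact: eval_free_is_multiplicative.2. Qed.

Lemma eval_free_gen i : eval_free x (gen K i) = x i.
Proof. by rewrite eval_freeU fmU big_seq1. Qed.

End Eval.

Lemma eq_eval_free (A : algType K) (x y : I -> A) :
  x =1 y -> eval_free x =1 eval_free y.
Proof. by move=> xy f; apply: eq_lin_comb => w; apply: eq_bigr => i _. Qed.

(** Substitutions compose; together with [eval_free_id] this makes inverse substitutions checkable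
    on generators only. *)
Lemma eval_free_comp (A : algType K) (x : I -> A) (g : I -> free_alg K I) f :
  eval_free x (eval_free g f) = eval_free (fun i => eval_free x (g i)) f.
Proof.
rewrite [X in eval_free x X]/eval_free linear_sum; apply: eq_bigr => w _.
by rewrite linearZ /= rmorph_prod.
Qed.

Lemma eval_free_id f : eval_free (@gen K I) f = f.
Proof.
pose idf : {linear free_alg K I -> free_alg K I} := idfun.
apply: (@malg_linear_ext _ _ _ (eval_free (@gen K I)) idf) => w.
rewrite /= eval_freeU; case: w => s; elim: s => [|i s IHs] /=.
  by rewrite big_nil -fmoneE.
rewrite big_cons IHs malgM_def fgmulUU mulr1; congr (<< _ >>).
by apply/eqP; rewrite fmP fmM fmU.
Qed.

Section Ideal.

Variable rs : seq (free_alg K I).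

Lemma in_ideal_gen r : r \in rs -> in_ideal rs r.
Proof.
by move=> rrs; exists [:: (1, r, 1)]; rewrite /= ?rrs // big_seq1 /= mul1r mulr1.
Qed.

Lemma in_ideal0 : in_ideal rs 0.
Proof. by exists [::] => //; rewrite big_nil. Qed.

Lemma in_idealD f g : in_ideal rs f -> in_ideal rs g -> in_ideal rs (f + g).
Proof.
move=> [s Hs ->] [t Ht ->]; exists (s ++ t); last by rewrite big_cat.
by rewrite all_cat Hs Ht.
Qed.

Lemma in_idealM u f v : in_ideal rs f -> in_ideal rs (u * f * v).
Proof.
move=> [s Hs ->]; exists [seq (u * t.1.1, t.1.2, t.2 * v) | t <- s].
  by rewrite all_map.
rewrite big_map mulr_sumr mulr_suml; apply: eq_bigr => t _.
have mulA5 (R : pzRingType) (a b c d e : R) : a * (b * c * d) * e = a * b * c * (d * e).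
  by rewrite !mulrA.
exact: mulA5.
Qed.

Lemma in_idealZ k f : in_ideal rs f -> in_ideal rs (k *: f).
Proof. by move/(in_idealM k%:A 1); rewrite mulr1 -scalerAl mul1r. Qed.

End Ideal.

(** Evaluation at [g] is an algebra morphism, so it suffices to test the generators of the ideal. *)
Lemma in_ideal_eval rs rs' (g : I -> free_alg K I) :
  (forall r, r \in rs -> in_ideal rs' (eval_free g r)) ->
  forall f, in_ideal rs f -> in_ideal rs' (eval_free g f).
Proof.
move=> H f [s + ->]; elim: s => [|t s IHs] /=.
  by rewrite big_nil linear0 => _; apply: in_ideal0.
case/andP=> /H Ht /IHs Hs; rewrite big_cons linearD !rmorphM.
exact: in_idealD (in_idealM _ _ Ht) Hs.
Qed.

(** Evaluations at [g] and [g'] are mutually inverse automorphisms of the free algebra matching the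
    ideals of [rs'] and [rs]. Evaluation at [y] is evaluation at [x] after the first one, so
    surjectivity and the kernel are transported. *)
Lemma presented_subst (A : algType K) (x y : I -> A) rs rs'
    (g g' : I -> free_alg K I) :
  (forall i, eval_free x (g i) = y i) ->
  (forall i, eval_free g (g' i) = gen K i) ->
  (forall i, eval_free g' (g i) = gen K i) ->
  (forall r, r \in rs' -> in_ideal rs (eval_free g r)) ->
  (forall r, r \in rs -> in_ideal rs' (eval_free g' r)) ->
  presented x rs -> presented y rs'.
Proof.
move=> xg gg' g'g sub' sub [sur ker].
have evalE f : eval_free y f = eval_free x (eval_free g f).
  by rewrite eval_free_comp; apply: eq_eval_free => i; rewrite xg.
have gK f : eval_free g' (eval_free g f) = f.
  by rewrite eval_free_comp (eq_eval_free g'g) eval_free_id.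
have g'K f : eval_free g (eval_free g' f) = f.
  by rewrite eval_free_comp (eq_eval_free gg') eval_free_id.
split=> [u|f].
  by have [f <-] := sur u; exists (eval_free g' f); rewrite evalE g'K.
rewrite evalE ker; split; last exact: in_ideal_eval.
by move/(in_ideal_eval sub); rewrite gK.
Qed.

End FreeAlgebra.

(** * Affine changes of generators *)

Section AffineChange.

Variable K : fieldType.

Definition affine_change (A : algType K) (lam mu : 'I_3 -> K) (x : 'I_3 -> A) i : A :=
  lam i *: x i + (mu i)%:A.

Lemma affine_changeK (A : algType K) (lam mu : 'I_3 -> K) (x : 'I_3 -> A) :
  (forall i, lam i != 0) ->
  affine_change (fun i => (lam i)^-1) (fun i => - (mu i / lam i))
    (affine_change lam mu x) =1 x.
Proof.
move=> lam0 i; rewrite /affine_change scalerDr !scalerA mulVf ?lam0 // scale1r.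
by rewrite -addrA -scalerDl mulrC subrr scale0r addr0.
Qed.

Lemma affine_changeVK (A : algType K) (lam mu : 'I_3 -> K) (x : 'I_3 -> A) :
  (forall i, lam i != 0) ->
  affine_change lam mu
    (affine_change (fun i => (lam i)^-1) (fun i => - (mu i / lam i)) x) =1 x.
Proof.
move=> lam0 i; rewrite /affine_change scalerDr !scalerA mulfV ?lam0 // scale1r.
by rewrite -addrA -scalerDl mulrN mulrCA mulfV ?lam0 // mulr1 addNr scale0r addr0.
Qed.

(** The coefficient of u^(n-i) in the binomial expansion of (l u + m)^n. *)
Definition affine_coef (l m : K) (n i : nat) : K := l ^+ (n - i) * m ^+ i *+ 'C(n, i).

Lemma affine_exp (A : algType K) (l m : K) (u : A) n :
  (l *: u + m%:A) ^+ n = \sum_(i < n.+1) affine_coef l m n i *: u ^+ (n - i).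
Proof.
have cum : GRing.comm (l *: u) m%:A.
  by rewrite /GRing.comm -!scalerAl -!scalerAr mul1r mulr1 !scalerA mulrC.
rewrite (exprDn_comm _ cum); apply: eq_bigr => i _.
by rewrite !exprZn expr1n -scalerAr mulr1 scalerA mulrC scalerMnl.
Qed.

(** The formal expansion of a PBW monomial in the changed generators. Each generator changes
    separately, so the factors stay in PBW order and the expansion is valid in every algebra. *)
Definition affine_pbw (lam mu : 'I_3 -> K) (m : nat * nat * nat) :
    {malg K[(nat * nat * nat)%type]} :=
  let: (n1, n2, n3) := m in
  \sum_(i < n1.+1) \sum_(j < n2.+1) \sum_(k < n3.+1)
    (affine_coef (lam i1) (mu i1) n1 i * affine_coef (lam i2) (mu i2) n2 j *
     affine_coef (lam i3) (mu i3) n3 k) *: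
    << ((n1 - i)%N, (n2 - j)%N, (n3 - k)%N) >>.

Lemma lin_comb_affine_pbw (A : algType K) lam mu (x : 'I_3 -> A) c :
  lin_comb (pbw_monomial x) (lin_comb (affine_pbw lam mu) c) =
  lin_comb (pbw_monomial (affine_change lam mu x)) c.
Proof.
rewrite lin_comb_map; apply: eq_lin_comb => -[[n1 n2] n3].
rewrite /affine_pbw /pbw_monomial /affine_change !affine_exp linear_sum !mulr_suml.
apply: eq_bigr => i _; rewrite linear_sum -mulrA mulr_suml mulr_sumr.
apply: eq_bigr => j _; rewrite linear_sum !mulr_sumr; apply: eq_bigr => k _.
by rewrite linearZ /= lin_combU /= -!scalerAl -!scalerAr !scalerA !mulrA.
Qed.

Lemma eq_pbw_monomial (A : algType K) (x y : 'I_3 -> A) :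
  x =1 y -> pbw_monomial x =1 pbw_monomial y.
Proof. by move=> xy [[n1 n2] n3]; rewrite /pbw_monomial !xy. Qed.

(* The coefficients in affine_pbw do not depend on A, so that any single algebra
   with a PBW basis shows that the substitutions given by an affine change and
   by its inverse are mutually inverse. *)
Lemma is_basis_affine (A : algType K) (lam mu : 'I_3 -> K) (x : 'I_3 -> A) :
  (forall i, lam i != 0) -> is_basis (pbw_monomial x) ->
  is_basis (pbw_monomial (affine_change lam mu x)).
Proof.
move=> lam0 [inj sur].
pose lam' i := (lam i)^-1; pose mu' i := - (mu i / lam i).
have K1 : cancel (lin_comb (affine_pbw lam mu)) (lin_comb (affine_pbw lam' mu')).
  move=> c; apply: inj; rewrite !lin_comb_affine_pbw.
  exact/eq_lin_comb/eq_pbw_monomial/affine_changeVK.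
have K2 : cancel (lin_comb (affine_pbw lam' mu')) (lin_comb (affine_pbw lam mu)).
  move=> c; apply: inj; rewrite !lin_comb_affine_pbw.
  exact/eq_lin_comb/eq_pbw_monomial/affine_changeK.
split=> [c c'|u].
  by rewrite -!lin_comb_affine_pbw => /inj/(can_inj K1).
have [c <-] := sur u; exists (lin_comb (affine_pbw lam' mu') c).
by rewrite -lin_comb_affine_pbw K2.
Qed.

Definition affine_gen (lam mu : 'I_3 -> K) : 'I_3 -> free_alg K 'I_3 :=
  affine_change lam mu (@gen K 'I_3).

Lemma eval_affine_gen (A : algType K) (lam mu : 'I_3 -> K) (x : 'I_3 -> A) i :
  eval_free x (affine_gen lam mu i) = affine_change lam mu x i.
Proof.
by rewrite /affine_gen /affine_change linearP linearZ /= eval_free1 eval_free_gen.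
Qed.

(** It suffices that relations match up to scalars. The second condition is also phrased with [g],
    so that only one substitution has to be computed; applying the inverse substitution recovers the
    form used by [presented_subst]. *)
Lemma presented_affine (A : algType K) (lam mu : 'I_3 -> K) (x : 'I_3 -> A)
    (rs rs' : seq (free_alg K 'I_3)) :
  let g := affine_gen lam mu in
  (forall i, lam i != 0) ->
  (forall r, r \in rs' -> exists k, exists2 r', r' \in rs & eval_free g r = k *: r') ->
  (forall r, r \in rs -> exists k, exists2 r', r' \in rs' & r = k *: eval_free g r') ->
  presented x rs -> presented (affine_change lam mu x) rs'.
Proof.
move=> g lam0 sub' sub.
pose g' := affine_gen (fun i => (lam i)^-1) (fun i => - (mu i / lam i)).
have g'g i : eval_free g' (g i) = gen K i.
  exact: etrans (eval_affine_gen _ _ _ _) (affine_changeVK _ _ lam0 i).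
have gg' i : eval_free g (g' i) = gen K i.
  exact: etrans (eval_affine_gen _ _ _ _) (affine_changeK _ _ lam0 i).
apply: (presented_subst (g := g) (g' := g') _ gg' g'g).
- exact: eval_affine_gen.
- by move=> r /sub'[k [r' r'rs ->]]; apply/in_idealZ/in_ideal_gen.
- move=> r /sub[k [r' r'rs ->]]; rewrite linearZ /= eval_free_comp.
  by rewrite (eq_eval_free g'g) eval_free_id; apply/in_idealZ/in_ideal_gen.
Qed.

(** The scalars [lam j * lam i] are those acquired by the leading products under the change. They
    are invertible, so the relations correspond in both directions. *)
Lemma biquadratic_affine (A : algType K) (lam mu : 'I_3 -> K) (x : 'I_3 -> A)
    q1 q2 q3 l1 l2 l3 l1' l2' l3' :
  let g := affine_gen lam mu in
  (forall i, lam i != 0) ->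
  eval_free g (biquad_rel i2 i1 q1 l1') = (lam i2 * lam i1) *: biquad_rel i2 i1 q1 l1 ->
  eval_free g (biquad_rel i3 i1 q2 l2') = (lam i3 * lam i1) *: biquad_rel i3 i1 q2 l2 ->
  eval_free g (biquad_rel i3 i2 q3 l3') = (lam i3 * lam i2) *: biquad_rel i3 i2 q3 l3 ->
  biquadratic x (q1, q2, q3) l1 l2 l3 ->
  biquadratic (affine_change lam mu x) (q1, q2, q3) l1' l2' l3'.
Proof.
move=> g lam0 E1 E2 E3 [q0 pres bas].
split; [exact: q0 | | exact: is_basis_affine].
have V i j (r r' : free_alg K 'I_3) :
    r' = (lam i * lam j) *: r -> r = (lam i * lam j)^-1 *: r'.
  by move->; rewrite scalerA mulVf ?scale1r // mulf_neq0.
apply: (presented_affine lam0) pres => r; rewrite !inE => /or3P[] /eqP ->.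
- exists (lam i2 * lam i1), (biquad_rel i2 i1 q1 l1); last exact: E1.
  by rewrite !inE; apply/or3P; apply: Or31 (eqxx _).
- exists (lam i3 * lam i1), (biquad_rel i3 i1 q2 l2); last exact: E2.
  by rewrite !inE; apply/or3P; apply: Or32 (eqxx _).
- exists (lam i3 * lam i2), (biquad_rel i3 i2 q3 l3); last exact: E3.
  by rewrite !inE; apply/or3P; apply: Or33 (eqxx _).
- exists (lam i2 * lam i1)^-1, (biquad_rel i2 i1 q1 l1'); last exact: V E1.
  by rewrite !inE; apply/or3P; apply: Or31 (eqxx _).
- exists (lam i3 * lam i1)^-1, (biquad_rel i3 i1 q2 l2'); last exact: V E2.
  by rewrite !inE; apply/or3P; apply: Or32 (eqxx _).
- exists (lam i3 * lam i2)^-1, (biquad_rel i3 i2 q3 l3'); last exact: V E3.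
  by rewrite !inE; apply/or3P; apply: Or33 (eqxx _).
Qed.

End AffineChange.

(** * Bi-quadratic relations under affine changes *)

(** The relation is taken in an arbitrary algebra, so that its formal version in the free algebra
    and its value in [A] are instances of one expression. *)
Definition biquad_expr (K : fieldType) (A : algType K) (z : 'I_3 -> A) (j i : 'I_3)
    (q : K) (l : K * K * K * K) : A :=
  let: (a, b, c, d) := l in
  z j * z i - q *: (z i * z j) - (a *: z i1 + b *: z i2 + c *: z i3 + d%:A).

Lemma eq_biquad_expr (K : fieldType) (A : algType K) (z z' : 'I_3 -> A) j i q l :
  z =1 z' -> biquad_expr z j i q l = biquad_expr z' j i q l.
Proof. by case: l => [[[a b] c] d] zz; rewrite /biquad_expr !zz. Qed.

Lemma biquad_relE (K : fieldType) j i (q : K) l :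
  biquad_rel j i q l = biquad_expr (@gen K 'I_3 : _ -> free_alg K 'I_3) j i q l.
Proof. by case: l => [[[a b] c] d]. Qed.

Lemma biquad_expr_map (K : fieldType) (A B : algType K) (h : {lrmorphism A -> B})
    (z : 'I_3 -> A) j i q l :
  h (biquad_expr z j i q l) = biquad_expr (fun k => h (z k)) j i q l.
Proof.
case: l => [[[a b] c] d]; rewrite /biquad_expr !(linearB, linearD, linearZ) /=.
by rewrite !rmorphM rmorph1.
Qed.

Lemma eval_biquad_rel (K : fieldType) (A : algType K) (z : 'I_3 -> A) j i q l :
  eval_free z (biquad_rel j i q l) = biquad_expr z j i q l.
Proof.
rewrite biquad_relE; apply: etrans (biquad_expr_map (eval_free z) _ _ _ _ _) _.
by apply: eq_biquad_expr; apply: eval_free_gen.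
Qed.

(* The hypothesis says that the affine parts agree, v and v0 being the values of
   the generators and of 1 under an arbitrary linear form. *)
Lemma biquad_expr_affine (K : fieldType) (A : algType K) (z : 'I_3 -> A)
    (phi : A -> K) (lam mu : 'I_3 -> K) j i q a b c d a' b' c' d' :
  scalar phi ->
  (forall (v : 'I_3 -> K) (v0 : K),
    lam j * lam i * (a * v i1 + b * v i2 + c * v i3 + d * v0) =
    a' * (lam i1 * v i1 + mu i1 * v0) + b' * (lam i2 * v i2 + mu i2 * v0)
    + c' * (lam i3 * v i3 + mu i3 * v0) + d' * v0
    - (1 - q) * (lam j * mu i * v j + lam i * mu j * v i + mu i * mu j * v0)) ->
  phi (biquad_expr (affine_change lam mu z) j i q (a', b', c', d')) =
  lam j * lam i * phi (biquad_expr z j i q (a, b, c, d)).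
Proof.
case/scalarDZ=> DE ZE /(_ (fun k => phi (z k)) (phi 1)) E.
have NE u : phi (- u) = - phi u by rewrite -scaleN1r ZE mulN1r.
rewrite /biquad_expr /affine_change.
rewrite !(mulrDl, mulrDr) -!scalerAl -!scalerAr !mulr1 !mul1r.
rewrite !(DE, NE, ZE).
move: E => /=.
move: (phi (z i1)) (phi (z i2)) (phi (z i3)) (phi (z i)) (phi (z j)) (phi 1).
move: (phi (z i * z j)) (phi (z j * z i)).
move=> vij vji v1 v2 v3 vi vj v0 E.
by rewrite mulrBr E; ring.
Qed.

(** Elements of the free algebra are equal when all their coefficients are; each coefficient is a
    linear form, to which [biquad_expr_affine] applies. What remains is an identity in [K], within
    reach of [ring]. *)
Lemma eval_affine_biquad_rel (K : fieldType) (lam mu : 'I_3 -> K) j i q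
    a b c d a' b' c' d' :
  (forall (v : 'I_3 -> K) (v0 : K),
    lam j * lam i * (a * v i1 + b * v i2 + c * v i3 + d * v0) =
    a' * (lam i1 * v i1 + mu i1 * v0) + b' * (lam i2 * v i2 + mu i2 * v0)
    + c' * (lam i3 * v i3 + mu i3 * v0) + d' * v0
    - (1 - q) * (lam j * mu i * v j + lam i * mu j * v i + mu i * mu j * v0)) ->
  eval_free (affine_gen lam mu) (biquad_rel j i q (a', b', c', d')) =
  (lam j * lam i) *: biquad_rel j i q (a, b, c, d).
Proof.
move=> E; rewrite eval_biquad_rel biquad_relE; apply/malgP => w.
have lin : scalar (fun u : free_alg K 'I_3 => u@_w).
  move=> k u v; exact: etrans (mcoeffD w (k *: u) v) (congr1 (+%R^~ _) (mcoeffZ k u w)).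
apply: etrans (esym (mcoeffZ _ _ _)).
exact: (@biquad_expr_affine K (free_alg K 'I_3) (@gen K 'I_3) (fun u => u@_w)
  _ _ _ _ _ _ _ _ _ _ _ _ _ lin E).
Qed.

(** * The overlap z y x and the vanishing coefficients *)

(* The left-hand side is phi (z (y x)) - phi ((z y) x), both products being
   expanded in the PBW monomials; phi is meant to be a coordinate form. *)
Lemma diamond (K : fieldType) (A : algType K) (x y z : A) (phi : A -> K)
    (p q c b1 beta gamma b2 lambda mu nu b3 : K) :
  scalar phi ->
  y * x = p *: (x * y) + c *: z + b1%:A ->
  z * x = q *: (x * z) + beta *: y + gamma *: z + b2%:A ->
  z * y = p *: (y * z) + lambda *: x + mu *: y + nu *: z + b3%:A ->
  let X := phi x in let Y := phi y in let Z := phi z in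
  (1 - p * q) * (c * phi (z * z) + b1 * Z)
    + (p * q - 1) * (lambda * phi (x * x) + b3 * X)
    + p * (q - 1) * mu * phi (x * y) + q * (p - 1) * nu * phi (x * z)
    + p * (p - 1) * gamma * phi (y * z)
    + p * gamma * (lambda * X + mu * Y + nu * Z + b3 * phi 1)
    - mu * (c * Z + b1 * phi 1) - nu * (beta * Y + gamma * Z + b2 * phi 1) = 0 :> K.
Proof.
case/scalarDZ=> DE ZE yx zx zy X Y Z.
have L : z * (y * x) = p *: (q *: (x * (z * y)) + beta *: (y * y) + gamma *: (z * y)
    + b2 *: y) + c *: (z * z) + b1 *: z.
  rewrite yx !mulrDr -!scalerAr mulr1 [z * (x * y)]mulrA zx.
  by rewrite !mulrDl -!scalerAl mul1r mulrA.
have R : z * (y * x) = p *: (q *: (y * x * z) + beta *: (y * y) + gamma *: (y * z)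
    + b2 *: y) + lambda *: (x * x) + mu *: (y * x) + nu *: (z * x) + b3 *: x.
  rewrite mulrA zy !mulrDl -!scalerAl mul1r -[y * z * x]mulrA zx.
  by rewrite !mulrDr -!scalerAr mulr1 mulrA.
have xzy : phi (x * (z * y)) = p * phi (x * y * z) + lambda * phi (x * x)
    + mu * phi (x * y) + nu * phi (x * z) + b3 * X.
  by rewrite zy !mulrDr -!scalerAr mulr1 !(DE, ZE) mulrA.
have yxz : phi (y * x * z) = p * phi (x * y * z) + c * phi (z * z) + b1 * Z.
  by rewrite yx !mulrDl -!scalerAl mul1r !(DE, ZE).
(* Since the outer relations share the same [p], the terms in x y z, in y^2 and the terms
   [p * b2 * Y] agree on both sides and cancel. This is why beta and b_2 can survive. *)
have := congr1 phi (etrans (esym L) R); rewrite !(DE, ZE) xzy yxz.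
rewrite yx zx zy !(DE, ZE) => /eqP; rewrite -subr_eq0 => /eqP <-.
by rewrite -/X -/Y -/Z; ring.
Qed.

(** Each coefficient is isolated by applying [diamond] to the coordinate form of one PBW monomial
    and dividing by a nonzero factor. *)
Lemma biquadratic_shifted_coefs (K : fieldType) (A : algType K) (x : 'I_3 -> A)
    (p q c b1 beta gamma b2 lambda mu nu b3 : K) :
  p != 1 -> q != 1 -> 1 - p * q != 0 ->
  biquadratic x (p, q, p) (0, 0, c, b1) (0, beta, gamma, b2) (lambda, mu, nu, b3) ->
  [/\ c = 0, b1 = 0, gamma = 0, lambda = 0 & [/\ mu = 0, nu = 0 & b3 = 0]].
Proof.
move=> p1 q1 pq [[p0 q0 _] [_ ker] bas].
set rs := [:: _; _; _] in ker.
have rel j i r l : biquad_rel j i r l \in rs -> biquad_expr x j i r l = 0.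
  by move=> /in_ideal_gen /ker; rewrite eval_biquad_rel.
have yx : x i2 * x i1 = p *: (x i1 * x i2) + c *: x i3 + b1%:A.
  have /eqP := rel i2 i1 p (0, 0, c, b1) (mem_head _ _).
  by rewrite /biquad_expr !scale0r !add0r !subr_eq add0r addrC addrA => /eqP.
have zx : x i3 * x i1 = q *: (x i1 * x i3) + beta *: x i2 + gamma *: x i3 + b2%:A.
  have rs2 : biquad_rel i3 i1 q (0, beta, gamma, b2) \in rs.
    by rewrite !inE; apply/or3P; apply: Or32 (eqxx _).
  have /eqP := rel _ _ _ _ rs2.
  by rewrite /biquad_expr !scale0r !add0r !subr_eq add0r addrC !addrA => /eqP.
have zy : x i3 * x i2 = p *: (x i2 * x i3) + lambda *: x i1 + mu *: x i2 + nu *: x i3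
    + b3%:A.
  have rs3 : biquad_rel i3 i2 p (lambda, mu, nu, b3) \in rs.
    by rewrite !inE; apply/or3P; apply: Or33 (eqxx _).
  have /eqP := rel _ _ _ _ rs3.
  by rewrite /biquad_expr !subr_eq add0r addrC !addrA => /eqP.
(* The values of the coordinate form at PBW monomials are Kronecker deltas. *)
have D i j k :
  let d m : K := (m == (i, j, k))%:R in
  let X := d (1, 0, 0)%N in let Y := d (0, 1, 0)%N in let Z := d (0, 0, 1)%N in
  (1 - p * q) * (c * d (0, 0, 2)%N + b1 * Z)
    + (p * q - 1) * (lambda * d (2, 0, 0)%N + b3 * X)
    + p * (q - 1) * mu * d (1, 1, 0)%N + q * (p - 1) * nu * d (1, 0, 1)%N
    + p * (p - 1) * gamma * d (0, 1, 1)%N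
    + p * gamma * (lambda * X + mu * Y + nu * Z + b3 * d (0, 0, 0)%N)
    - mu * (c * Z + b1 * d (0, 0, 0)%N)
    - nu * (beta * Y + gamma * Z + b2 * d (0, 0, 0)%N) = 0.
  have [phi lin val] := basis_coord (i, j, k) bas.
  have := diamond lin yx zx zy; rewrite /= -!val /pbw_monomial.
  by rewrite !expr0 !expr1 !expr2 !mulr1 !mul1r.
have nz (u v : K) : u != 0 -> u * v = 0 -> v = 0.
  by move=> u0 /eqP; rewrite mulf_eq0 (negPf u0) => /eqP.
have p1' : p - 1 != 0 by rewrite subr_eq0.
have q1' : q - 1 != 0 by rewrite subr_eq0.
have c0 : c = 0.
  apply: (nz _ _ pq); rewrite -(D 0 0 2)%N /=; ring.
have mu0 : mu = 0.
  apply: (nz (p * (q - 1))); rewrite ?mulf_neq0 // -(D 1 1 0)%N /=; ring.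
have nu0 : nu = 0.
  apply: (nz (q * (p - 1))); rewrite ?mulf_neq0 // -(D 1 0 1)%N /=; ring.
have gamma0 : gamma = 0.
  apply: (nz (p * (p - 1))); rewrite ?mulf_neq0 // -(D 0 1 1)%N /=; ring.
have lambda0 : lambda = 0.
  apply: (nz _ _ pq); apply: oppr_inj; rewrite oppr0 -(D 2 0 0)%N /=; ring.
(* At the monomial x a product of gamma and lambda also occurs, so gamma is eliminated first; at z
   below, mu must have vanished too. *)
have b30 : b3 = 0.
  apply: (nz _ _ pq); apply: oppr_inj; rewrite oppr0 -(D 1 0 0)%N gamma0 /=; ring.
have b10 : b1 = 0.
  apply: (nz _ _ pq); rewrite -(D 0 0 1)%N gamma0 mu0 /=; ring.
by [].
Qed.

(** * Normalisation of the parameters *)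

Section Triple.

Variables (K : fieldType) (u1 u2 u3 : K).

Definition triple (i : 'I_3) : K := [:: u1; u2; u3]`_i.

Lemma tripleE : (triple i1 = u1) * (triple i2 = u2) * (triple i3 = u3).
Proof. by rewrite /triple !inordK. Qed.

Lemma triple_neq0 : u1 != 0 -> u2 != 0 -> u3 != 0 -> forall i, triple i != 0.
Proof. by move=> n1 n2 n3 [[|[|[|i]]]]. Qed.

End Triple.

Theorem theorem1p8 (K : fieldType) (A : algType K) (x : 'I_3 -> A)
    (q1 q2 q3 a b c b1 alpha beta gamma b2 lambda mu nu b3 : K)
    (hA : biquadratic x (q1, q2, q3)
            (a, b, c, b1) (alpha, beta, gamma, b2) (lambda, mu, nu, b3))
    (hq1 : q1 != 1) (hq2 : q2 != 1) (hq3 : q3 != 1)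
    (hq13 : q1 - q3 = 0) (hq12 : 1 - q1 * q2 != 0) :
  exists (y : 'I_3 -> A) (beta' b2' : K),
    [/\ G3' x y,
        beta' = 0 \/ beta' = 1,
        b2' = 0 \/ b2' = 1
      & biquadratic y (q1, q2, q1)
          (0, 0, 0, 0) (0, beta', 0, b2') (0, 0, 0, 0)].
Proof.
have q31 : q3 = q1 by apply/esym/eqP; rewrite -subr_eq0 hq13.
subst q3.
have nq1 : 1 - q1 != 0 by rewrite subr_eq0 eq_sym.
have nq2 : 1 - q2 != 0 by rewrite subr_eq0 eq_sym.
(* Translating the generators by [s1], [s2], [s3] turns b, a, alpha into [b + (1 - q1) * s1],
   [a + (1 - q1) * s2], [alpha + (1 - q2) * s3]; these are the solutions making them zero. *)
pose s1 := - b / (1 - q1); pose s2 := - a / (1 - q1); pose s3 := - alpha / (1 - q2).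
have s1E : (1 - q1) * s1 = - b by rewrite mulrC divfK.
have s2E : (1 - q1) * s2 = - a by rewrite mulrC divfK.
have s3E : (1 - q2) * s3 = - alpha by rewrite mulrC divfK.
pose y := affine_change (triple 1 1 1) (triple s1 s2 s3) x.
have xy : G3' x y.
  by apply: G3'_affine (G3'_id x) _; apply: triple_neq0; apply: oner_neq0.
pose gamma' := gamma + (1 - q2) * s1.
pose mu' := mu + (1 - q1) * s3.
pose nu' := nu + (1 - q1) * s2.
have [b1' [b2' [b3' hy]]] : exists b1' b2' b3', biquadratic y (q1, q2, q1)
    (0, 0, c, b1') (0, beta, gamma', b2') (lambda, mu', nu', b3').
  (* The new constants come from substituting x_i = y_i - s_i and comparing constant terms, with the
     new linear coefficients inserted. *)
  exists (b1 + (1 - q1) * s1 * s2 - c * s3).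
  exists (b2 + (1 - q2) * s1 * s3 - beta * s2 - gamma' * s3).
  exists (b3 + (1 - q1) * s2 * s3 - lambda * s1 - mu' * s2 - nu' * s3).
  apply: biquadratic_affine hA; first by apply: triple_neq0; apply: oner_neq0.
  - apply: eval_affine_biquad_rel => v v0; rewrite !tripleE.
    (* Expressing a and b through the translations removes the divisions, leaving a polynomial
       identity. *)
    rewrite -[a]opprK -[b]opprK -s1E -s2E; ring.
  - apply: eval_affine_biquad_rel => v v0; rewrite !tripleE.
    rewrite -[alpha]opprK -s3E /gamma'; ring.
  - apply: eval_affine_biquad_rel => v v0; rewrite !tripleE /mu' /nu'; ring.
have [c0 b10 g0 l0 [m0 n0 b30]] := biquadratic_shifted_coefs hq1 hq2 hq12 hy.
move: hy; rewrite c0 b10 g0 l0 m0 n0 b30 => hy.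
(* Scaling x by [r1] and y by [r2], with z fixed, turns b_2 into [r1 * b2'] and beta into
   [r1 * beta / r2]. A parameter that is already zero imposes no condition, and the scale 1 is
   taken. *)
pose r1 := if b2' == 0 then 1 else b2'^-1.
pose r2 := if beta == 0 then 1 else r1 * beta.
have r10 : r1 != 0.
  by rewrite /r1; case: (eqVneq b2' 0) => *; rewrite ?oner_neq0 ?invr_neq0.
have r20 : r2 != 0.
  by rewrite /r2; case: (eqVneq beta 0) => *; rewrite ?oner_neq0 ?mulf_neq0.
have b2E : r1 * b2' = (b2' != 0)%:R.
  by rewrite /r1; case: (eqVneq b2' 0) => [->|?]; rewrite ?mulr0 ?mulVf.
(* Stated without division, in the form in which y is replaced by its multiple by [r2]. *)
have betaE : r1 * beta = (beta != 0)%:R * r2.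
  by rewrite /r2; case: (eqVneq beta 0) => [->|?]; rewrite ?mulr0 ?mul0r ?mul1r.
have bit (B : bool) : B%:R = 0 \/ B%:R = 1 :> K by case: B; [right | left].
have rn0 : forall i, triple r1 r2 1 i != 0 by apply: triple_neq0; rewrite ?oner_neq0.
exists (affine_change (triple r1 r2 1) (triple 0 0 0) y).
exists (beta != 0)%:R, (b2' != 0)%:R.
split; [exact: G3'_affine | exact: bit | exact: bit |].
apply: biquadratic_affine hy => //.
- apply: eval_affine_biquad_rel => v v0; rewrite !tripleE; ring.
- apply: eval_affine_biquad_rel => v v0; rewrite !tripleE -b2E.
  have -> : 1 * r1 * (0 * v i1 + beta * v i2 + 0 * v i3 + b2' * v0) =
    r1 * beta * v i2 + r1 * b2' * v0 by ring.
  rewrite betaE; ring.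
- apply: eval_affine_biquad_rel => v v0; rewrite !tripleE; ring.
Qed.
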